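(* Let $\Bbbk$ be a field, let $\sigma$ be a $\Bbbk$-algebra automorphism of the Laurent polynomial ring $\Bbbk[h^{\pm 1}]$, and let $a\in\Bbbk[h^{\pm 1}]$. Then the generalized Weyl algebra $\Bbbk[h^{\pm 1}](\sigma,a)$ is isomorphic (as a $\Bbbk$-algebra) to a member of one, and only one, of the following three families (in each, the defining element $a$ ranges over $\Bbbk[h^{\pm 1}]$): 1. $\Bbbk[h^{\pm 1}](\mathrm{id},a)$; 2. $\Bbbk[h^{\pm 1}](\sigma_q,a)$, where $\sigma_q(h)=qh$ with $q\in\Bbbk^*$ and $q\neq 1$; 3. $\Bbbk[h^{\pm 1}](\sigma_{inv},a)$, where $\sigma_{inv}(h)=qh^{-1}$ with $q\in\Bbbk^*$.
   Context: For a $\Bbbk$-algebra $R$, a $\Bbbk$-algebra automorphism $\sigma$ of $R$ and a central element $a\in R$, the (degree-one) generalized Weyl algebra $R(\sigma,a)$ is the $\Bbbk$-algebra extension of $R$ generated by two indeterminates $x$ and $y$ subject to the relations $yx=a$, $xy=\sigma(a)$, $xr=\sigma(r)x$ and $yr=\sigma^{-1}(r)y$ for all $r\in R$. *)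

(* Defs.v *)
From HB Require Import structures.
From mathcomp Require Import all_boot all_order all_algebra ring.
From mathcomp Require Import boolp.

Set Implicit Arguments.
Unset Strict Implicit.
Unset Printing Implicit Defensive.

Import GRing.Theory.
Local Open Scope ring_scope.
Local Open Scope quotient_scope.

Local Notation "p %:F" := (tofrac p).

Record algAut (k : fieldType) (R : algType k) := AlgAut {
  aut_fun :> {lrmorphism R -> R};
  aut_inv : R -> R;
  aut_funK : cancel aut_fun aut_inv;
  aut_invK : cancel aut_inv aut_fun }.

Definition algIso (k : fieldType) (A B : algType k) : Prop :=
  exists f : {lrmorphism A -> B}, bijective f.

(* The Laurent polynomials, as the subring k[X][1/X] of the field k(X). *)
Definition is_laurent (k : fieldType) : pred {fraction {poly k}} :=
  fun f => `[< exists (p : {poly k}) (n : nat),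
                 f = p%:F / ('X^n : {poly k})%:F >].

Section LaurentClosed.
Variable k : fieldType.

Lemma tofracXn_neq0 n : ('X^n : {poly k})%:F != 0.
Proof. by rewrite tofrac_eq0 monic_neq0 ?monicXn. Qed.

Lemma is_laurent_subring : subring_closed (@is_laurent k).
Proof.
split.
- by apply/asboolP; exists 1, 0%N; rewrite expr0 tofrac1 divr1.
- move=> f g /asboolP[p [n ->]] /asboolP[q [m ->]]; apply/asboolP.
  exists (p * 'X^m - q * 'X^n), (n + m)%N.
  rewrite exprD tofracB !tofracM mulrBl; congr (_ - _).
    by rewrite -mulf_div divff ?mulr1 ?tofracXn_neq0.
  by rewrite [X in _ = _ / X]mulrC -mulf_div divff ?mulr1 ?tofracXn_neq0.
- move=> f g /asboolP[p [n ->]] /asboolP[q [m ->]]; apply/asboolP.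
  by exists (p * q), (n + m)%N; rewrite exprD !tofracM mulf_div.
Qed.

HB.instance Definition _ :=
  GRing.isSubringClosed.Build _ (@is_laurent k) is_laurent_subring.

End LaurentClosed.

Record laurent (k : fieldType) := Laurent {
  laurent_val : {fraction {poly k}};
  laurent_valP : laurent_val \in @is_laurent k }.

Section LaurentRing.
Variable k : fieldType.

HB.instance Definition _ := [isSub for @laurent_val k].
HB.instance Definition _ := [Choice of laurent k by <:].
HB.instance Definition _ := [SubChoice_isSubComNzRing of laurent k by <:].

Lemma laurent_polyP (p : {poly k}) : p%:F \in @is_laurent k.
Proof. by apply/asboolP; exists p, 0%N; rewrite expr0 tofrac1 divr1. Qed.

Definition laurent_poly (p : {poly k}) : laurent k := Laurent (laurent_polyP p).

Lemma laurent_poly_zmod : zmod_morphism laurent_poly.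
Proof. by move=> p q; apply/val_inj; rewrite rmorphB /= tofracB. Qed.
HB.instance Definition _ :=
  GRing.isZmodMorphism.Build {poly k} (laurent k) laurent_poly laurent_poly_zmod.
Lemma laurent_poly_monoid : monoid_morphism laurent_poly.
Proof.
split; first by apply/val_inj; rewrite [RHS]rmorph1 /= tofrac1.
by move=> p q; apply/val_inj; rewrite rmorphM /= tofracM.
Qed.
HB.instance Definition _ :=
  GRing.isMonoidMorphism.Build {poly k} (laurent k) laurent_poly
    laurent_poly_monoid.

Definition laurent_scale (c : k) (f : laurent k) := laurent_poly c%:P * f.

Fact laurent_scaleA c d f :
  laurent_scale c (laurent_scale d f) = laurent_scale (c * d) f.
Proof. by rewrite /laurent_scale mulrA -rmorphM -polyCM. Qed.
Fact laurent_scale1 : left_id 1 laurent_scale.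
Proof. by move=> f; rewrite /laurent_scale rmorph1 mul1r. Qed.
Fact laurent_scaleDr : right_distributive laurent_scale +%R.
Proof. by move=> c f g; rewrite /laurent_scale mulrDr. Qed.
Fact laurent_scaleDl f : {morph laurent_scale^~ f : c d / c + d}.
Proof. by move=> c d; rewrite /laurent_scale polyCD rmorphD mulrDl. Qed.

HB.instance Definition _ := GRing.Zmodule_isLmodule.Build k (laurent k)
  laurent_scaleA laurent_scale1 laurent_scaleDr laurent_scaleDl.

Fact laurent_scaleAl (c : k) (f g : laurent k) : c *: (f * g) = c *: f * g.
Proof. exact: mulrA. Qed.
HB.instance Definition _ :=
  GRing.Lmodule_isLalgebra.Build k (laurent k) laurent_scaleAl.
HB.instance Definition _ := GRing.Lalgebra_isComAlgebra.Build k (laurent k).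

Definition laurent_h : laurent k := laurent_poly 'X.

Fact laurent_hVP : ('X : {poly k})%:F^-1 \in @is_laurent k.
Proof. by apply/asboolP; exists 1, 1%N; rewrite expr1 tofrac1 div1r. Qed.

Definition laurent_hV : laurent k := Laurent laurent_hVP.

Lemma laurent_mulhV : laurent_h * laurent_hV = 1.
Proof.
apply/val_inj; rewrite rmorphM rmorph1 /= divff //.
by have := tofracXn_neq0 k 1; rewrite expr1.
Qed.

Lemma laurent_polyE (p : {poly k}) : laurent_poly p = horner_alg laurent_h p.
Proof.
elim/poly_ind: p => [|p c IHp]; first by rewrite !rmorph0.
rewrite !rmorphD !rmorphM /= IHp horner_algX horner_algC; congr (_ + _).
by rewrite -[LHS]mulr1.
Qed.

Lemma laurentP (f : laurent k) :
  exists p n, f = horner_alg laurent_h p * laurent_hV ^+ n.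
Proof.
case: f => f fP; have /asboolP[p [n fE]] := fP; exists p, n.
apply/val_inj; rewrite -laurent_polyE rmorphM rmorphXn /= fE.
by rewrite exprVn tofracXn.
Qed.

Lemma laurent_poly_inj : injective laurent_poly.
Proof. by move=> p q /(congr1 val) /= /eqP; rewrite tofrac_eq => /eqP. Qed.

Lemma laurent_hom_ext (B : algType k) (f g : {lrmorphism laurent k -> B}) :
  f laurent_h = g laurent_h -> f =1 g.
Proof.
move=> fgh; have fgV : f laurent_hV = g laurent_hV.
  have fV : f laurent_hV * f laurent_h = 1.
    by rewrite -rmorphM mulrC laurent_mulhV rmorph1.
  have gV : g laurent_h * g laurent_hV = 1.
    by rewrite -rmorphM laurent_mulhV rmorph1.
  by rewrite -[LHS]mulr1 -gV mulrA -fgh fV mul1r.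
have fgp p : f (horner_alg laurent_h p) = g (horner_alg laurent_h p).
  elim/poly_ind: p => [|p c IHp]; first by rewrite !rmorph0.
  rewrite !(rmorphD, rmorphM) /= horner_algX horner_algC IHp fgh.
  by rewrite !linearZ !rmorph1.
move=> x; have [p [n ->]] := laurentP x.
by rewrite !rmorphM !rmorphXn /= fgp fgV.
Qed.

Section Eval.
Variables (B : comAlgType k) (u v : B).
Hypothesis uv1 : u * v = 1.

(* The algebra morphism with h |-> u and h^-1 |-> v; it does not depend on the
   chosen representation f = p / h^n (laurent_evalE). *)
Definition laurent_eval of u * v = 1 := fun f : laurent k =>
  let: p := projT1 (cid (laurentP f)) in
  let: n := projT1 (cid (projT2 (cid (laurentP f)))) in
  horner_alg u p * v ^+ n : B.
Local Notation laurent_ev := (laurent_eval uv1).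

Lemma laurent_evalE p n :
  laurent_ev (laurent_poly p * laurent_hV ^+ n) = horner_alg u p * v ^+ n.
Proof.
rewrite /laurent_eval; case: (cid _) => /= q q_ex; case: (cid _) => /= m.
rewrite -laurent_polyE => /(congr1 (fun f => f * laurent_h ^+ (n + m))) E.
have hX (j : nat) : laurent_h ^+ j * laurent_hV ^+ j = 1.
  by rewrite -exprMn laurent_mulhV expr1n.
have uX (j : nat) : u ^+ j * v ^+ j = 1 by rewrite -exprMn uv1 expr1n.
have {}E : p * 'X^m = q * 'X^n.
  apply: laurent_poly_inj; rewrite !rmorphM !rmorphXn /=.
  rewrite -[LHS]mulr1 -(hX n) -[RHS]mulr1 -(hX m).
  transitivity (laurent_poly p * laurent_hV ^+ n * laurent_h ^+ (n + m)).
    by rewrite exprD; ring.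
  by rewrite E exprD; ring.
have /(congr1 (horner_alg u)) := E.
rewrite !rmorphM !rmorphXn /= horner_algX => {}E.
rewrite -[LHS]mulr1 -(uX n) -[RHS]mulr1 -(uX m).
transitivity (horner_alg u p * u ^+ m * (v ^+ n * v ^+ m)).
  by rewrite E; ring.
by ring.
Qed.

Lemma laurent_polyVP f : exists p n, f = laurent_poly p * laurent_hV ^+ n.
Proof.
by have [p [n ->]] := laurentP f; exists p, n; rewrite laurent_polyE.
Qed.

Lemma laurent_eval_zmod : zmod_morphism laurent_ev.
Proof.
move=> f g; have [p [n ->]] := laurent_polyVP f.
have [q [m ->]] := laurent_polyVP g.
have hX (j : nat) : laurent_h ^+ j * laurent_hV ^+ j = 1.
  by rewrite -exprMn laurent_mulhV expr1n.
have uX (j : nat) : u ^+ j * v ^+ j = 1 by rewrite -exprMn uv1 expr1n.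
have -> : laurent_poly p * laurent_hV ^+ n - laurent_poly q * laurent_hV ^+ m
        = laurent_poly (p * 'X^m - q * 'X^n) * laurent_hV ^+ (n + m).
  rewrite rmorphB !rmorphM !rmorphXn /= -/laurent_h exprD.
  rewrite -[X in X - _]mulr1 -(hX m) -[X in _ - X]mulr1 -(hX n).
  by ring.
rewrite !laurent_evalE rmorphB !rmorphM !rmorphXn /= horner_algX exprD.
rewrite -[X in _ = X - _]mulr1 -(uX m) -[X in _ = _ - X]mulr1 -(uX n).
by ring.
Qed.
HB.instance Definition _ :=
  GRing.isZmodMorphism.Build (laurent k) B laurent_ev laurent_eval_zmod.

Lemma laurent_eval_monoid : monoid_morphism laurent_ev.
Proof.
split.
  have := laurent_evalE 1 0.
  by rewrite !rmorph1 !expr0 !mulr1.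
move=> f g; have [p [n ->]] := laurent_polyVP f.
have [q [m ->]] := laurent_polyVP g.
have -> : laurent_poly p * laurent_hV ^+ n * (laurent_poly q * laurent_hV ^+ m)
        = laurent_poly (p * q) * laurent_hV ^+ (n + m).
  by rewrite rmorphM exprD mulrACA.
by rewrite !laurent_evalE rmorphM exprD mulrACA.
Qed.
HB.instance Definition _ :=
  GRing.isMonoidMorphism.Build (laurent k) B laurent_ev laurent_eval_monoid.

Lemma laurent_eval_scalable : scalable laurent_ev.
Proof.
move=> c f; have [p [n ->]] := laurent_polyVP f.
have -> : c *: (laurent_poly p * laurent_hV ^+ n)
        = laurent_poly (c *: p) * laurent_hV ^+ n.
  by rewrite -mul_polyC rmorphM -mulrA.
by rewrite !laurent_evalE linearZ /= -!scalerAl mul1r.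
Qed.
HB.instance Definition _ :=
  GRing.isScalable.Build k (laurent k) B *:%R laurent_ev
    laurent_eval_scalable.

Lemma laurent_eval_h : laurent_ev laurent_h = u.
Proof. by have := laurent_evalE 'X 0; rewrite !expr0 !mulr1 horner_algX. Qed.

Lemma laurent_eval_hV : laurent_ev laurent_hV = v.
Proof.
by have := laurent_evalE 1 1; rewrite !rmorph1 !expr1 !mul1r.
Qed.

End Eval.
End LaurentRing.

Section LaurentAut.
Variables (k : fieldType) (q : k).
Hypothesis q_neq0 : q != 0.

Fact scale_autP : (q *: laurent_h k) * (q^-1 *: laurent_hV k) = 1.
Proof.
by rewrite -scalerAl -scalerAr scalerA divff // scale1r laurent_mulhV.
Qed.

Fact scale_autVP : (q^-1 *: laurent_h k) * (q *: laurent_hV k) = 1.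
Proof.
by rewrite -scalerAl -scalerAr scalerA mulVf // scale1r laurent_mulhV.
Qed.

Fact inv_autP : (q *: laurent_hV k) * (q^-1 *: laurent_h k) = 1.
Proof. by rewrite mulrC scale_autVP. Qed.

Fact scale_autK : cancel (laurent_eval scale_autP) (laurent_eval scale_autVP).
Proof.
apply: (laurent_hom_ext (f := laurent_eval scale_autVP \o laurent_eval scale_autP)
         (g := idfun)).
by rewrite /= laurent_eval_h linearZ /= laurent_eval_h scalerA divff ?scale1r.
Qed.

Fact scale_autVK : cancel (laurent_eval scale_autVP) (laurent_eval scale_autP).
Proof.
apply: (laurent_hom_ext (f := laurent_eval scale_autP \o laurent_eval scale_autVP)
         (g := idfun)).
by rewrite /= laurent_eval_h linearZ /= laurent_eval_h scalerA mulVf ?scale1r.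
Qed.

Fact inv_autK : involutive (laurent_eval inv_autP).
Proof.
apply: (laurent_hom_ext (f := laurent_eval inv_autP \o laurent_eval inv_autP)
         (g := idfun)).
by rewrite /= laurent_eval_h linearZ /= laurent_eval_hV scalerA divff ?scale1r.
Qed.

(* h |-> q h *)
Definition scale_aut : algAut (laurent k) := AlgAut scale_autK scale_autVK.
(* h |-> q h^-1 *)
Definition inv_aut : algAut (laurent k) := AlgAut inv_autK inv_autK.

Lemma scale_autE : scale_aut (laurent_h k) = q *: laurent_h k.
Proof. exact: laurent_eval_h. Qed.
Lemma inv_autE : inv_aut (laurent_h k) = q *: laurent_hV k.
Proof. exact: laurent_eval_h. Qed.

End LaurentAut.

Section GWA.
Variables (k : fieldType) (R : algType k).

(* Expressions in the elements of R and the indeterminates x and y. *)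
Inductive gwa_term : Type :=
  | GConst of R
  | GX
  | GY
  | GAdd of gwa_term & gwa_term
  | GOpp of gwa_term
  | GMul of gwa_term & gwa_term.

HB.instance Definition _ := gen_eqMixin gwa_term.
HB.instance Definition _ := gen_choiceMixin gwa_term.

Variables (sigma : algAut R) (a : R).

(* The least congruence making the expressions a k-algebra, GConst a k-algebra
   morphism from R (gwa_scalar says that the scalars are central), and the
   defining relations of R(sigma, a) true. *)
Inductive gwa_rel : gwa_term -> gwa_term -> Prop :=
  | gwa_refl s : gwa_rel s s
  | gwa_sym s t : gwa_rel s t -> gwa_rel t s
  | gwa_trans s t u : gwa_rel s t -> gwa_rel t u -> gwa_rel s u
  | gwa_congD s s' t t' :
      gwa_rel s s' -> gwa_rel t t' -> gwa_rel (GAdd s t) (GAdd s' t')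
  | gwa_congN s s' : gwa_rel s s' -> gwa_rel (GOpp s) (GOpp s')
  | gwa_congM s s' t t' :
      gwa_rel s s' -> gwa_rel t t' -> gwa_rel (GMul s t) (GMul s' t')
  | gwa_addA s t u : gwa_rel (GAdd s (GAdd t u)) (GAdd (GAdd s t) u)
  | gwa_addC s t : gwa_rel (GAdd s t) (GAdd t s)
  | gwa_add0 s : gwa_rel (GAdd (GConst 0) s) s
  | gwa_addN s : gwa_rel (GAdd (GOpp s) s) (GConst 0)
  | gwa_mulA s t u : gwa_rel (GMul s (GMul t u)) (GMul (GMul s t) u)
  | gwa_mul1l s : gwa_rel (GMul (GConst 1) s) s
  | gwa_mul1r s : gwa_rel (GMul s (GConst 1)) s
  | gwa_mulDl s t u :
      gwa_rel (GMul (GAdd s t) u) (GAdd (GMul s u) (GMul t u))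
  | gwa_mulDr s t u :
      gwa_rel (GMul s (GAdd t u)) (GAdd (GMul s t) (GMul s u))
  | gwa_constD r r' : gwa_rel (GConst (r + r')) (GAdd (GConst r) (GConst r'))
  | gwa_constM r r' : gwa_rel (GConst (r * r')) (GMul (GConst r) (GConst r'))
  | gwa_scalar c s : gwa_rel (GMul (GConst c%:A) s) (GMul s (GConst c%:A))
  | gwa_yx : gwa_rel (GMul GY GX) (GConst a)
  | gwa_xy : gwa_rel (GMul GX GY) (GConst (sigma a))
  | gwa_xr r : gwa_rel (GMul GX (GConst r)) (GMul (GConst (sigma r)) GX)
  | gwa_yr r :
      gwa_rel (GMul GY (GConst r)) (GMul (GConst (aut_inv sigma r)) GY).

Definition gwa_relb (s t : gwa_term) : bool := `[< gwa_rel s t >].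

Fact gwa_relb_refl : reflexive gwa_relb.
Proof. by move=> s; apply/asboolP/gwa_refl. Qed.
Fact gwa_relb_sym : symmetric gwa_relb.
Proof. by move=> s t; apply/asboolP/asboolP; apply: gwa_sym. Qed.
Fact gwa_relb_trans : transitive gwa_relb.
Proof.
by move=> t s u /asboolP st /asboolP tu; apply/asboolP/(gwa_trans st tu).
Qed.

Canonical gwa_equiv :=
  EquivRel gwa_relb gwa_relb_refl gwa_relb_sym gwa_relb_trans.

(* The relations are only meant for a central a, hence the last argument. *)
Definition gwa of (forall r, a * r = r * a) : Type := {eq_quot gwa_relb}.

(* The action of the expressions on functions int -> R that comes from the
   skew Laurent ring R[x^+-1; sigma], with y = a x^-1; it only serves to show
   that 1 != 0 in R(sigma, a). *)
Section Action.
Hypothesis aC : forall r, a * r = r * a.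

Definition aut_pow (n : int) (r : R) : R :=
  match n with
  | Posz m => iter m sigma r
  | Negz m => iter m.+1 (aut_inv sigma) r
  end.

Lemma aut_inv_eq r s : sigma s = r -> aut_inv sigma r = s.
Proof. by move=> <-; rewrite aut_funK. Qed.

Lemma aut_powD n : {morph aut_pow n : r s / r + s}.
Proof.
case: n => m r s.
  by elim: m => //= m ->; rewrite rmorphD.
rewrite /aut_pow; elim: m.+1 => //= j ->.
by apply: aut_inv_eq; rewrite rmorphD /= !aut_invK.
Qed.

Lemma aut_powM n : {morph aut_pow n : r s / r * s}.
Proof.
case: n => m r s.
  by elim: m => //= m ->; rewrite rmorphM.
rewrite /aut_pow; elim: m.+1 => //= j ->.
by apply: aut_inv_eq; rewrite rmorphM /= !aut_invK.
Qed.

Lemma aut_powA n c : aut_pow n c%:A = c%:A.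
Proof.
have sA : sigma c%:A = c%:A by rewrite linearZ /= rmorph1.
case: n => m; first by elim: m => //= m ->.
by rewrite /aut_pow; elim: m.+1 => //= j ->; apply: aut_inv_eq.
Qed.

Lemma aut_powS n r : aut_pow (n + 1) r = aut_pow n (sigma r).
Proof.
case: n => [m|[|m]].
- by rewrite -PoszD addn1 /aut_pow iterSr.
- by rewrite /= aut_funK.
- have -> : Negz m.+1 + 1 = Negz m by rewrite !NegzE -addn1 PoszD opprD addrNK.
  by rewrite /aut_pow [RHS]iterSr aut_funK.
Qed.

Lemma aut_powV n r : aut_pow (n - 1) r = aut_pow n (aut_inv sigma r).
Proof. by rewrite -[in RHS](subrK 1 n) aut_powS aut_invK. Qed.

Fixpoint gwa_act (t : gwa_term) (f : int -> R) : int -> R :=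
  match t with
  | GConst r => fun n => aut_pow n r * f n
  | GX => fun n => f (n + 1)
  | GY => fun n => aut_pow n a * f (n - 1)
  | GAdd s t => fun n => gwa_act s f n + gwa_act t f n
  | GOpp s => fun n => - gwa_act s f n
  | GMul s t => gwa_act s (gwa_act t f)
  end.

Lemma gwa_actD t f g n :
  gwa_act t (fun n => f n + g n) n = gwa_act t f n + gwa_act t g n.
Proof.
elim: t f g n => [r|||s IHs t IHt|s IHs|s IHs t IHt] f g n /=.
- by rewrite mulrDr.
- by [].
- by rewrite mulrDr.
- by rewrite IHs IHt addrACA.
- by rewrite IHs opprD.
- by rewrite -IHs; congr (gwa_act s _ n); apply/funext => m; rewrite IHt.
Qed.

Lemma gwa_actZ t c f n :
  gwa_act t (fun n => c *: f n) n = c *: gwa_act t f n.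
Proof.
elim: t f n => [r|||s IHs t IHt|s IHs|s IHs t IHt] f n /=.
- by rewrite scalerAr.
- by [].
- by rewrite scalerAr.
- by rewrite IHs IHt scalerDr.
- by rewrite IHs scalerN.
- by rewrite -IHs; congr (gwa_act s _ n); apply/funext => m; rewrite IHt.
Qed.

Lemma aut_pow0 n : aut_pow n 0 = 0.
Proof. by have := aut_powA n 0; rewrite scale0r. Qed.
Lemma aut_pow1 n : aut_pow n 1 = 1.
Proof. by have := aut_powA n 1; rewrite scale1r. Qed.

Lemma gwa_actP s t : gwa_rel s t -> gwa_act s = gwa_act t.
Proof.
elim=> {s t} //=; try by move=> *; congruence.
all: try by move=> ? ? ? ? _ -> _ ->.
- by move=> s s' _ ->.
- by move=> s t u; do 2!apply/funext => ?; rewrite addrA.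
- by move=> s t; do 2!apply/funext => ?; rewrite addrC.
- by move=> s; do 2!apply/funext => ?; rewrite aut_pow0 mul0r add0r.
- by move=> s; do 2!apply/funext => ?; rewrite aut_pow0 mul0r addNr.
- by move=> s; do 2!apply/funext => ?; rewrite aut_pow1 mul1r.
- move=> s; apply/funext => f; congr (gwa_act s _).
  by apply/funext => n; rewrite aut_pow1 mul1r.
- by move=> s t u; do 2!apply/funext => ?; rewrite gwa_actD.
- by move=> r r'; do 2!apply/funext => ?; rewrite aut_powD mulrDl.
- by move=> r r'; do 2!apply/funext => ?; rewrite aut_powM mulrA.
- move=> c s; apply/funext => f; apply/funext => n.
  rewrite aut_powA -scalerAl mul1r -gwa_actZ; congr (gwa_act s _ n).
  by apply/funext => m; rewrite aut_powA -scalerAl mul1r.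
- by do 2!apply/funext => ?; rewrite subrK.
- by do 2!apply/funext => ?; rewrite aut_powS addrK.
- by move=> r; do 2!apply/funext => ?; rewrite aut_powS.
- move=> r; do 2!apply/funext => ?.
  by rewrite aut_powV !mulrA -!aut_powM aC.
Qed.

Lemma gwa_rel10 : ~ gwa_rel (GConst 1) (GConst 0).
Proof.
move=> /gwa_actP /(congr1 (fun F => F (fun=> 1) 0)) /= /eqP.
by rewrite !mulr1 oner_eq0.
Qed.

End Action.

Section Ring.
Variable aC : forall r, a * r = r * a.
Local Notation A := (gwa aC).

HB.instance Definition _ := Choice.on A.
HB.instance Definition _ : EqQuotient gwa_term gwa_relb A := EqQuotient.on A.

Definition gwa_pi (t : gwa_term) : A := \pi t.

Lemma gwa_piP s t : gwa_pi s = gwa_pi t <-> gwa_rel s t.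
Proof. by split=> [/eqmodP/asboolP|st] //; apply/eqmodP/asboolP. Qed.

Lemma gwa_piK (u : A) : gwa_pi (repr u) = u.
Proof. exact: reprK. Qed.

Lemma gwa_repr t : gwa_rel (repr (gwa_pi t)) t.
Proof. by apply/gwa_piP; rewrite gwa_piK. Qed.

Definition gwa_add (u v : A) : A := gwa_pi (GAdd (repr u) (repr v)).
Definition gwa_opp (u : A) : A := gwa_pi (GOpp (repr u)).
Definition gwa_mul (u v : A) : A := gwa_pi (GMul (repr u) (repr v)).

Lemma gwa_piD s t : gwa_pi (GAdd s t) = gwa_add (gwa_pi s) (gwa_pi t).
Proof. by apply/gwa_piP/gwa_congD; apply/gwa_sym/gwa_repr. Qed.
Lemma gwa_piN s : gwa_pi (GOpp s) = gwa_opp (gwa_pi s).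
Proof. by apply/gwa_piP/gwa_congN; apply/gwa_sym/gwa_repr. Qed.
Lemma gwa_piM s t : gwa_pi (GMul s t) = gwa_mul (gwa_pi s) (gwa_pi t).
Proof. by apply/gwa_piP/gwa_congM; apply/gwa_sym/gwa_repr. Qed.

Lemma gwa_ind (P : A -> Prop) : (forall t, P (gwa_pi t)) -> forall u, P u.
Proof. by move=> Ppi u; rewrite -(gwa_piK u). Qed.

Fact gwa_addrA : associative gwa_add.
Proof.
elim/gwa_ind=> s; elim/gwa_ind=> t; elim/gwa_ind=> u.
by rewrite -!gwa_piD; apply/gwa_piP/gwa_addA.
Qed.
Fact gwa_addrC : commutative gwa_add.
Proof.
elim/gwa_ind=> s; elim/gwa_ind=> t.
by rewrite -!gwa_piD; apply/gwa_piP/gwa_addC.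
Qed.
Fact gwa_add0r : left_id (gwa_pi (GConst 0)) gwa_add.
Proof.
by elim/gwa_ind=> s; rewrite -!gwa_piD; apply/gwa_piP/gwa_add0.
Qed.
Fact gwa_addNr : left_inverse (gwa_pi (GConst 0)) gwa_opp gwa_add.
Proof.
by elim/gwa_ind=> s; rewrite -gwa_piN -!gwa_piD; apply/gwa_piP/gwa_addN.
Qed.

HB.instance Definition _ :=
  GRing.isZmodule.Build A gwa_addrA gwa_addrC gwa_add0r gwa_addNr.

Fact gwa_mulrA : associative gwa_mul.
Proof.
elim/gwa_ind=> s; elim/gwa_ind=> t; elim/gwa_ind=> u.
by rewrite -!gwa_piM; apply/gwa_piP/gwa_mulA.
Qed.
Fact gwa_lid : left_id (gwa_pi (GConst 1)) gwa_mul.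
Proof.
by elim/gwa_ind=> s; rewrite -!gwa_piM; apply/gwa_piP/gwa_mul1l.
Qed.
Fact gwa_rid : right_id (gwa_pi (GConst 1)) gwa_mul.
Proof.
by elim/gwa_ind=> s; rewrite -!gwa_piM; apply/gwa_piP/gwa_mul1r.
Qed.
Fact gwa_mulrDl : left_distributive gwa_mul gwa_add.
Proof.
elim/gwa_ind=> s; elim/gwa_ind=> t; elim/gwa_ind=> u.
by rewrite -!(gwa_piM, gwa_piD); apply/gwa_piP/gwa_mulDl.
Qed.
Fact gwa_mulrDr : right_distributive gwa_mul gwa_add.
Proof.
elim/gwa_ind=> s; elim/gwa_ind=> t; elim/gwa_ind=> u.
by rewrite -!(gwa_piM, gwa_piD); apply/gwa_piP/gwa_mulDr.
Qed.
Fact gwa_oner_neq0 : gwa_pi (GConst 1) != gwa_pi (GConst 0).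
Proof. by apply/eqP => /gwa_piP; exact: gwa_rel10. Qed.

HB.instance Definition _ := GRing.Zmodule_isNzRing.Build A
  gwa_mulrA gwa_lid gwa_rid gwa_mulrDl gwa_mulrDr gwa_oner_neq0.

Definition gwa_const (r : R) : A := gwa_pi (GConst r).
Definition gwa_x : A := gwa_pi GX.
Definition gwa_y : A := gwa_pi GY.

Fact gwa_constD_eq r s : gwa_const (r + s) = gwa_const r + gwa_const s.
Proof. by rewrite /gwa_const -[RHS]gwa_piD; apply/gwa_piP/gwa_constD. Qed.
Fact gwa_constM_eq r s : gwa_const (r * s) = gwa_const r * gwa_const s.
Proof. by rewrite /gwa_const -[RHS]gwa_piM; apply/gwa_piP/gwa_constM. Qed.

Definition gwa_scale (c : k) (u : A) : A := gwa_const c%:A * u.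

Fact gwa_scalerA c d u : gwa_scale c (gwa_scale d u) = gwa_scale (c * d) u.
Proof.
by rewrite /gwa_scale mulrA -gwa_constM_eq -scalerAl mul1r scalerA.
Qed.
Fact gwa_scale1r : left_id 1 gwa_scale.
Proof. by move=> u; rewrite /gwa_scale scale1r [LHS]mul1r. Qed.
Fact gwa_scalerDr : right_distributive gwa_scale +%R.
Proof. by move=> c u v; rewrite /gwa_scale mulrDr. Qed.
Fact gwa_scalerDl u : {morph gwa_scale^~ u : c d / c + d}.
Proof. by move=> c d; rewrite /gwa_scale scalerDl gwa_constD_eq mulrDl. Qed.

HB.instance Definition _ := GRing.Zmodule_isLmodule.Build k A
  gwa_scalerA gwa_scale1r gwa_scalerDr gwa_scalerDl.

Fact gwa_scalerAl (c : k) (u v : A) : c *: (u * v) = c *: u * v.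
Proof. exact: mulrA. Qed.
HB.instance Definition _ := GRing.Lmodule_isLalgebra.Build k A gwa_scalerAl.

Fact gwa_scalerAr (c : k) (u v : A) : c *: (u * v) = u * (c *: v).
Proof.
suff cC : gwa_const c%:A * u = u * gwa_const c%:A.
  by rewrite [LHS]mulrA cC -mulrA.
elim/gwa_ind: u => s; rewrite /gwa_const -[LHS]gwa_piM -[RHS]gwa_piM.
exact/gwa_piP/gwa_scalar.
Qed.
HB.instance Definition _ := GRing.Lalgebra_isAlgebra.Build k A gwa_scalerAr.

Fact gwa_const_zmod : zmod_morphism gwa_const.
Proof.
move=> r s; apply: (addIr (gwa_const s)).
by rewrite -gwa_constD_eq !subrK.
Qed.
HB.instance Definition _ :=
  GRing.isZmodMorphism.Build R A gwa_const gwa_const_zmod.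
Fact gwa_const_monoid : monoid_morphism gwa_const.
Proof. by split=> // r s; exact: gwa_constM_eq. Qed.
HB.instance Definition _ :=
  GRing.isMonoidMorphism.Build R A gwa_const gwa_const_monoid.
Fact gwa_const_scalable : scalable gwa_const.
Proof. by move=> c r; rewrite -[in LHS](mul1r r) scalerAl gwa_constM_eq. Qed.
HB.instance Definition _ :=
  GRing.isScalable.Build k R A *:%R gwa_const gwa_const_scalable.

Lemma gwa_yxE : gwa_y * gwa_x = gwa_const a.
Proof. by rewrite -[LHS]gwa_piM; exact/gwa_piP/gwa_yx. Qed.
Lemma gwa_xyE : gwa_x * gwa_y = gwa_const (sigma a).
Proof. by rewrite -[LHS]gwa_piM; exact/gwa_piP/gwa_xy. Qed.
Lemma gwa_xrE r : gwa_x * gwa_const r = gwa_const (sigma r) * gwa_x.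
Proof. by rewrite -[LHS]gwa_piM -[RHS]gwa_piM; exact/gwa_piP/gwa_xr. Qed.
Lemma gwa_yrE r : gwa_y * gwa_const r = gwa_const (aut_inv sigma r) * gwa_y.
Proof. by rewrite -[LHS]gwa_piM -[RHS]gwa_piM; exact/gwa_piP/gwa_yr. Qed.

Section Lift.
Variables (B : algType k) (phi : {lrmorphism R -> B}) (x y : B).

Fixpoint gwa_eval (t : gwa_term) : B :=
  match t with
  | GConst r => phi r
  | GX => x
  | GY => y
  | GAdd s t => gwa_eval s + gwa_eval t
  | GOpp s => - gwa_eval s
  | GMul s t => gwa_eval s * gwa_eval t
  end.

Definition gwa_lift_fun (u : A) : B := gwa_eval (repr u).

Hypotheses (yx : y * x = phi a) (xy : x * y = phi (sigma a)).
Hypothesis xr : forall r, x * phi r = phi (sigma r) * x.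
Hypothesis yr : forall r, y * phi r = phi (aut_inv sigma r) * y.

Lemma gwa_evalP s t : gwa_rel s t -> gwa_eval s = gwa_eval t.
Proof.
elim=> {s t} //=; try by move=> *; congruence.
- by move=> *; rewrite addrA.
- by move=> *; rewrite addrC.
- by move=> *; rewrite rmorph0 add0r.
- by move=> *; rewrite rmorph0 addNr.
- by move=> *; rewrite mulrA.
- by move=> *; rewrite rmorph1 mul1r.
- by move=> *; rewrite rmorph1 mulr1.
- by move=> *; rewrite mulrDl.
- by move=> *; rewrite mulrDr.
- by move=> *; rewrite rmorphD.
- by move=> *; rewrite rmorphM.
- by move=> *; rewrite linearZ /= rmorph1 mulr_algl mulr_algr.
Qed.

Lemma gwa_lift_pi t : gwa_lift_fun (gwa_pi t) = gwa_eval t.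
Proof. exact/gwa_evalP/gwa_repr. Qed.

Lemma gwa_lift : exists f : {lrmorphism A -> B},
  [/\ forall r, f (gwa_const r) = phi r, f gwa_x = x & f gwa_y = y].
Proof.
have fB : zmod_morphism gwa_lift_fun.
  elim/gwa_ind=> s; elim/gwa_ind=> t.
  have -> : gwa_pi s - gwa_pi t = gwa_pi (GAdd s (GOpp t)).
    by rewrite gwa_piD gwa_piN.
  by rewrite !gwa_lift_pi.
have fM : monoid_morphism gwa_lift_fun.
  split; first by rewrite [LHS]gwa_lift_pi /= rmorph1.
  by elim/gwa_ind=> s; elim/gwa_ind=> t; rewrite -[X in gwa_lift_fun X]gwa_piM !gwa_lift_pi.
have fZ : scalable gwa_lift_fun.
  move=> c u; rewrite [c *: u]/(gwa_const c%:A * u) fM.2.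
  by rewrite gwa_lift_pi /= linearZ /= rmorph1 mulr_algl.
pose mB := GRing.isZmodMorphism.Build A B gwa_lift_fun fB.
pose mM := GRing.isMonoidMorphism.Build A B gwa_lift_fun fM.
pose mZ := GRing.isScalable.Build k A B *:%R gwa_lift_fun fZ.
pose f : {lrmorphism A -> B} := HB.pack gwa_lift_fun mB mM mZ.
by exists f; split=> [r||]; rewrite [LHS]gwa_lift_pi.
Qed.

Lemma gwa_hom_ext (f g : {lrmorphism A -> B}) :
    (forall r, f (gwa_const r) = g (gwa_const r)) ->
  f gwa_x = g gwa_x -> f gwa_y = g gwa_y -> f =1 g.
Proof.
move=> fgr fgx fgy; elim/gwa_ind; elim=> //.
- by move=> s IHs t IHt; rewrite gwa_piD !rmorphD /= IHs IHt.
- by move=> s IHs; rewrite gwa_piN !rmorphN /= IHs.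
- by move=> s IHs t IHt; rewrite gwa_piM !rmorphM /= IHs IHt.
Qed.
End Lift.

End Ring.
End GWA.

Section Families.
Variable k : fieldType.

Definition id_aut : algAut (laurent k) :=
  @AlgAut k (laurent k) idfun id (fun=> erefl) (fun=> erefl).

Definition laurent_gwa (sigma : algAut (laurent k)) (a : laurent k) :
  algType k := gwa sigma (mulrC a).

Definition in_id_family (A : algType k) : Prop :=
  exists a : laurent k, algIso A (laurent_gwa id_aut a).

Definition in_scale_family (A : algType k) : Prop :=
  exists (q : k) (q_neq0 : q != 0) (a : laurent k),
    q != 1 /\ algIso A (laurent_gwa (scale_aut q_neq0) a).

Definition in_inv_family (A : algType k) : Prop :=
  exists (q : k) (q_neq0 : q != 0) (a : laurent k),
    algIso A (laurent_gwa (inv_aut q_neq0) a).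

End Families.

(* Main.v *)
(* The units of k[h^+-1] are the c h^n, so an automorphism sends h to q h or
   to q h^-1, which gives the existence of a family.

   Since x r = sigma(r) x, the algebra is commutative exactly when sigma = id,
   which separates the first family from the other two. For these two, look at
   morphisms to commutative algebras. Over sigma_q with q <> 1, the relation
   x h = q h x with h invertible kills x, and likewise y, so the image is a
   quotient of k[h^+-1]. Over sigma_inv, there is a morphism to
   E[x, y]/(xy - beta) = E(id, beta), where E = k[h]/(h^2 - q), whose image
   contains the transcendental x and the non-scalar square root h of q. A proper
   quotient of k[h^+-1] is finite-dimensional, hence has no transcendental
   element, and k[h^+-1] itself has no non-scalar element whose square is a
   nonzero scalar. *)

From HB Require Import structures.
Require Import Defs.
From mathcomp Require Import all_boot all_algebra.
From mathcomp Require Import ring.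

Set Implicit Arguments.
Unset Strict Implicit.
Unset Printing Implicit Defensive.

Import GRing.Theory.
Local Open Scope ring_scope.

(** * Units and automorphisms of the Laurent polynomial ring *)

Section LaurentUnits.
Variable k : fieldType.
Local Notation h := (laurent_h k).
Local Notation hV := (laurent_hV k).

Lemma laurent_hXK n : h ^+ n * hV ^+ n = 1.
Proof. by rewrite -exprMn laurent_mulhV expr1n. Qed.

Lemma laurent_polyZ (c : k) p : laurent_poly (c *: p) = c *: laurent_poly p.
Proof. by rewrite -mul_polyC rmorphM. Qed.

Lemma laurent_scale_hX_inj (c d : k) i j :
  c != 0 -> c *: h ^+ i = d *: h ^+ j -> c = d /\ i = j.
Proof.
move=> c0; rewrite -!rmorphXn /= -!laurent_polyZ => /laurent_poly_inj E.
have Ei : c = d * (i == j)%:R.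
  by have := congr1 (fun p : {poly k} => p`_i) E;
     rewrite !coefZ !coefXn eqxx mulr1.
case: eqP Ei => [-> ->|_ ce]; first by rewrite mulr1.
by rewrite ce mulr0 eqxx in c0.
Qed.

(** Multiplying by [h ^+ i] leaves [c] equal to [d *: h ^+ (j + i)], so [j + i = 0]. *)
Lemma laurent_scale_hVX_hX (c d : k) i j :
  c != 0 -> c *: hV ^+ i = d *: h ^+ j -> (c = d) * (i = 0%N) * (j = 0%N).
Proof.
move=> c0 /(congr1 (fun f => f * h ^+ i)).
rewrite -!scalerAl -exprD [X in c *: X]mulrC laurent_hXK => E.
have [->] := laurent_scale_hX_inj (i := 0) c0 E.
by case: i j {E} => [|i] [|j].
Qed.

(** Clearing denominators turns [u * v = 1] into [p * p' = 'X^(n + m)], and up to a scalar the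
    divisors of a power of ['X] are powers of ['X]. *)
Lemma laurent_unitP (u v : laurent k) : u * v = 1 ->
  exists c i, c != 0 /\ (u = c *: h ^+ i \/ u = c *: hV ^+ i).
Proof.
have [p [n ->]] := laurent_polyVP u; have [p' [m ->]] := laurent_polyVP v.
move=> /(congr1 (fun f => f * h ^+ (n + m))).
have -> : laurent_poly p * hV ^+ n * (laurent_poly p' * hV ^+ m) * h ^+ (n + m)
  = laurent_poly (p * p') * (h ^+ (n + m) * hV ^+ (n + m)).
  by rewrite rmorphM [hV ^+ (n + m)]exprD; ring.
rewrite laurent_hXK mulr1 mul1r -rmorphXn => /laurent_poly_inj E.
have : p %| ('X - 0%:P) ^+ (n + m) by rewrite subr0 -E dvdp_mulr.
move/dvdp_exp_XsubCP => [j _]; rewrite subr0 => /eqpP[[c1 c2] /= /andP[c10 c20]].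
move=> /(congr1 (fun f => c1^-1 *: f)); rewrite !scalerA mulVf // scale1r => ->.
have c0 : c1^-1 * c2 != 0 by rewrite mulf_neq0 ?invr_eq0.
rewrite laurent_polyZ rmorphXn /= -/h -scalerAl.
case: (leqP n j) => [|/ltnW] /subnKC <-.
  exists (c1^-1 * c2), (j - n)%N; split=> //; left.
  by rewrite exprD mulrAC laurent_hXK mul1r.
exists (c1^-1 * c2), (n - j)%N; split=> //; right.
by rewrite exprD mulrA laurent_hXK mul1r.
Qed.

(** Such an [r] is a unit with inverse [q^-1 *: r], hence a scaled power of [h] or [hV]; its square
    is a scalar only for exponent 0. *)
Lemma laurent_sqr_scalar (r : laurent k) (q : k) :
  q != 0 -> r ^+ 2 = q%:A -> exists c, r = c%:A.
Proof.
move=> q0 rq; have : r * (q^-1 *: r) = 1.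
  by rewrite -scalerAr -expr2 rq scalerA mulVf // scale1r.
case/laurent_unitP=> c [i [c0 [] re]]; exists c; move: rq;
  rewrite {}re exprZn -exprM.
  rewrite -(expr0 h) => /(laurent_scale_hX_inj (expf_neq0 2 c0)) [_].
  by case: i => // i; rewrite muln2.
rewrite -(expr0 h) => /(laurent_scale_hVX_hX (expf_neq0 2 c0)) [[_]].
by case: i => // i; rewrite muln2.
Qed.

(** Both [sigma h] and the preimage [r] of [h] are units. With exponents [i] and [m] up to sign,
    [sigma r = h] forces [i * m = 1]. *)
Lemma laurent_aut_h (sigma : algAut (laurent k)) :
  exists q, q != 0 /\ (sigma h = q *: h \/ sigma h = q *: hV).
Proof.
have shV : sigma h * sigma hV = 1 by rewrite -rmorphM laurent_mulhV rmorph1.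
have [r rh] : exists r, sigma r = h by exists (aut_inv sigma h); rewrite aut_invK.
have [r' rhV] : exists r, sigma r = hV.
  by exists (aut_inv sigma hV); rewrite aut_invK.
have rr' : r * r' = 1.
  apply: (can_inj (@aut_funK _ _ sigma)).
  by rewrite rmorphM /= rh rhV rmorph1 laurent_mulhV.
have [d [m [d0 rE]]] := laurent_unitP rr'.
have [c [i [c0 sE]]] := laurent_unitP shV.
have uniq_inv (u v w : laurent k) : u * v = 1 -> u * w = 1 -> v = w.
  by move=> uv uw; rewrite -[v]mulr1 -uw mulrA [v * u]mulrC uv mul1r.
have sV : [\/ sigma h = c *: h ^+ i /\ sigma hV = c^-1 *: hV ^+ i |
              sigma h = c *: hV ^+ i /\ sigma hV = c^-1 *: h ^+ i].
  case: sE => sh; [left|right]; split=> //; apply: uniq_inv shV _;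
  by rewrite sh -scalerAl -scalerAr scalerA divff // scale1r
    1?[_ * h ^+ _]mulrC laurent_hXK.
(* Of the four sign combinations, the two mixed ones make [h] a scaled nonpositive power of [h],
   which is absurd. *)
exists c; split=> //; move: rh.
case: sV => [] [sh sv]; case: rE => ->;
  rewrite linearZ rmorphXn /= ?sh ?sv exprZn scalerA -exprM.
- rewrite -{2}(scale1r h) -{2}(expr1 h) => /laurent_scale_hX_inj[|_].
    by rewrite mulf_neq0 ?expf_neq0.
  by move/eqP; rewrite muln_eq1 => /andP[/eqP-> _]; left; rewrite expr1.
- rewrite -{1}(scale1r h) -{1}(expr1 h) => /laurent_scale_hVX_hX[|_].
    by rewrite mulf_neq0 ?expf_neq0 ?invr_neq0.
  by [].
- rewrite -{1}(scale1r h) -{1}(expr1 h) => /laurent_scale_hVX_hX[|_].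
    by rewrite mulf_neq0 ?expf_neq0.
  by [].
- rewrite -{2}(scale1r h) -{2}(expr1 h) => /laurent_scale_hX_inj[|_].
    by rewrite mulf_neq0 ?expf_neq0 ?invr_neq0.
  by move/eqP; rewrite muln_eq1 => /andP[/eqP-> _]; right; rewrite expr1.
Qed.

End LaurentUnits.

(** * Algebraicity in proper quotients of the Laurent polynomials *)

Section LaurentAlgebraic.
Variables (k : fieldType) (B : algType k) (G : {lrmorphism laurent k -> B}).

(* If s h^n is a polynomial and d is the degree of p, then the d + 1 residues
   modulo p of the polynomials s^i h^(n d), i <= d, are linearly dependent. *)
Lemma laurent_ker_algebraic (p : {poly k}) (s : laurent k) :
    p != 0 -> G (laurent_poly p) = 0 ->
  exists m (c : 'I_m -> k),
    (exists i, c i != 0) /\ \sum_i c i *: G s ^+ i = 0.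
Proof.
move=> p0 Gp; have [P [n sE]] := laurent_polyVP s.
pose d := (size p).-1; pose w (i : 'I_d.+1) := P ^+ i * 'X^(n * (d - i)).
pose M : 'M[k]_(d.+1, d) := \matrix_i poly_rV (w i %% p).
have [v vM v0] : exists2 v : 'rV_d.+1, v *m M = 0 & v != 0.
  exists (nz_row (kermx M)); first exact/sub_kermxP/nz_row_sub.
  by rewrite nz_row_eq0 -mxrank_eq0 mxrank_ker -lt0n subn_gt0 ltnS rank_leq_col.
exists d.+1, (v 0); split.
  by have /rV0Pn := v0.
have sz q : (size (q %% p)%R <= d)%N.
  by rewrite -ltnS /d prednK ?size_poly_gt0 // ltn_modp.
have wE : \sum_i v 0 i *: (w i %% p) = 0.
  apply/polyP => j; rewrite coef0 coef_sum; case: (ltnP j d) => [jd|dj].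
    have /rowP/(_ (Ordinal jd)) := vM; rewrite !mxE => vMj.
    by rewrite -[RHS]vMj; apply: eq_bigr => i _; rewrite !mxE coefZ.
  by apply: big1 => i _; rewrite coefZ nth_default ?mulr0 // (leq_trans (sz _)).
have dvd : p %| \sum_i v 0 i *: w i.
  rewrite /dvdp -[X in X %% p]addr0.
  suff -> : (\sum_i v 0 i *: w i + 0) %% p = \sum_i v 0 i *: (w i %% p).
    by rewrite wE.
  rewrite addr0 (big_morph (fun q => q %% p) (fun x y => modpD p x y) (mod0p p)).
  by apply: eq_bigr => i _; rewrite modpZl.
have GQ : G (laurent_poly (\sum_i v 0 i *: w i)) = 0.
  by have /dvdpP[q ->] := dvd; rewrite !rmorphM /= Gp mulr0.
(* Multiplication by [h^-(n d)] turns each [w i] back into [s ^+ i]. *)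
have -> : \sum_i v 0 i *: G s ^+ i =
    G (laurent_poly (\sum_i v 0 i *: w i) * laurent_hV k ^+ (n * d)).
  rewrite rmorph_sum /= mulr_suml rmorph_sum; apply: eq_bigr => i _.
  rewrite laurent_polyZ -scalerAl [RHS]linearZ /= -rmorphXn; congr (_ *: G _).
  rewrite sE exprMn rmorphM !rmorphXn /= -/(laurent_h k) -mulrA -exprM.
  have -> : (n * d = n * (d - i) + n * i)%N.
    by rewrite -mulnDr subnK // -ltnS.
  by congr (_ * _); rewrite exprD mulrA laurent_hXK mul1r.
by rewrite rmorphM /= GQ mul0r.
Qed.

End LaurentAlgebraic.

(** * Algebra isomorphisms *)

Section AlgIso.
Variable k : fieldType.

Lemma algIso_sym (A B : algType k) : algIso A B -> algIso B A.
Proof.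
move=> [f [g fK gK]].
pose mB := GRing.isZmodMorphism.Build B A g (can2_zmod_morphism fK gK).
pose mM := GRing.isMonoidMorphism.Build B A g (can2_monoid_morphism fK gK).
pose mZ := GRing.isScalable.Build k B A *:%R g (can2_scalable fK gK).
pose g' : {lrmorphism B -> A} := HB.pack g mB mM mZ.
by exists g', f.
Qed.

Lemma algIso_trans (A B C : algType k) :
  algIso A B -> algIso B C -> algIso A C.
Proof.
move=> [f f_bij] [g g_bij]; exists (g \o f : {lrmorphism _ -> _}).
exact: bij_comp.
Qed.

Lemma algIso_comm (A B : algType k) :
  algIso A B -> commutative (@GRing.mul B) -> commutative (@GRing.mul A).
Proof.
by move=> [f /bij_inj f_inj] BC u v; apply: f_inj; rewrite !rmorphM BC.
Qed.

End AlgIso.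

(** * Detecting elements of a generalized Weyl algebra by its action *)

Section GWATheory.
Variables (k : fieldType) (R : algType k) (sigma : algAut R) (a : R).
Variable aC : forall r, a * r = r * a.
Local Notation A := (gwa sigma aC).
Local Notation const := (gwa_const sigma aC).
Local Notation x := (gwa_x sigma aC).
Local Notation y := (gwa_y sigma aC).

Lemma gwa_elim (P : A -> Prop) :
    (forall r, P (const r)) -> P x -> P y ->
    (forall u v, P u -> P v -> P (u + v)) ->
    (forall u, P u -> P (- u)) ->
    (forall u v, P u -> P v -> P (u * v)) ->
  forall u, P u.
Proof.
move=> Pc Px Py PD PN PM; elim/gwa_ind; elim=> //.
- by move=> s Ps t Pt; rewrite gwa_piD; apply: PD.
- by move=> s Ps; rewrite gwa_piN; apply: PN.
- by move=> s Ps t Pt; rewrite gwa_piM; apply: PM.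
Qed.

(** The action of expressions on functions [int -> R] respects [gwa_rel], so it descends to the
    quotient. Elements are told apart by evaluating their operators. *)
Definition gwa_apply (u : A) : (int -> R) -> int -> R :=
  gwa_act sigma a (repr u).

Lemma gwa_apply_pi t : gwa_apply (gwa_pi sigma aC t) = gwa_act sigma a t.
Proof. exact/(gwa_actP aC)/gwa_repr. Qed.

Lemma gwa_applyD u v f n :
  gwa_apply (u + v) f n = gwa_apply u f n + gwa_apply v f n.
Proof.
elim/gwa_ind: u => s; elim/gwa_ind: v => t.
by rewrite -[_ + _](gwa_piD sigma aC) !gwa_apply_pi.
Qed.

Lemma gwa_applyM u v f : gwa_apply (u * v) f = gwa_apply u (gwa_apply v f).
Proof.
elim/gwa_ind: u => s; elim/gwa_ind: v => t.
by rewrite -[_ * _](gwa_piM sigma aC) !gwa_apply_pi.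
Qed.

Lemma gwa_apply_const r f n : gwa_apply (const r) f n = aut_pow sigma n r * f n.
Proof. by rewrite gwa_apply_pi. Qed.

Lemma gwa_apply_xX i f n : gwa_apply (x ^+ i) f n = f (n + i%:Z).
Proof.
elim: i n => [|i IHi] n.
  by rewrite expr0 (gwa_apply_const 1) aut_pow1 mul1r addr0.
by rewrite exprS gwa_applyM gwa_apply_pi /= IHi -addrA -PoszD.
Qed.

Lemma gwa_applyZ c u f n : gwa_apply (c *: u) f n = c *: gwa_apply u f n.
Proof.
rewrite -[c *: u]/(const c%:A * u) gwa_applyM gwa_apply_const aut_powA.
by rewrite mulr_algl.
Qed.

Lemma gwa_apply_sum I (r : seq I) (F : I -> A) f n :
  gwa_apply (\sum_(i <- r) F i) f n = \sum_(i <- r) gwa_apply (F i) f n.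
Proof.
apply: (big_morph (fun u => gwa_apply u f n)).
  by move=> u v; apply: gwa_applyD.
by rewrite (gwa_apply_const 0) aut_pow0 mul0r.
Qed.

Lemma gwa_const_inj : injective const.
Proof.
move=> r s /(congr1 (fun u => gwa_apply u (fun=> 1) 0)).
by rewrite !gwa_apply_const !mulr1.
Qed.

Lemma gwa_comm_aut : commutative (@GRing.mul A) -> sigma =1 id.
Proof.
move=> AC r; have := AC x (const r); rewrite gwa_xrE.
(* The factor [x] on the right acts as a shift, which fixes the constant function 1, so it drops out
   without being cancelled in the algebra. *)
move=> /(congr1 (fun u => gwa_apply u (fun=> 1) 0)).
by rewrite !gwa_applyM !gwa_apply_const gwa_apply_pi /= !mulr1.
Qed.

(** As [x ^+ i] shifts by [i], applying the sum to the indicator function of [j] and reading the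
    result at 0 isolates [c j]. *)
Lemma gwa_x_transcendental m (c : 'I_m -> k) :
  \sum_i c i *: x ^+ i = 0 -> forall i, c i = 0.
Proof.
move=> /[swap] j /(congr1 (fun u => gwa_apply u (fun z => (z == j%:Z)%:R) 0)).
rewrite gwa_apply_sum (gwa_apply_const 0) mul0r (bigD1 j) //= big1 => [|i ij].
  rewrite addr0 gwa_applyZ gwa_apply_xX add0r eqxx => /eqP.
  by rewrite scaler_eq0 oner_eq0 orbF => /eqP.
by rewrite gwa_applyZ gwa_apply_xX add0r eqz_nat
           (inj_eq val_inj) (negPf ij) scaler0.
Qed.

End GWATheory.

(** * Invariance under pointwise equality of automorphisms *)

Section EqualAut.
Variables (k : fieldType) (R : algType k) (a : R).
Variable aC : forall r, a * r = r * a.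

Lemma gwa_eq_aut_hom (sigma tau : algAut R) : sigma =1 tau ->
  exists f : {lrmorphism gwa sigma aC -> gwa tau aC},
    [/\ forall r, f (gwa_const sigma aC r) = gwa_const tau aC r,
        f (gwa_x sigma aC) = gwa_x tau aC &
        f (gwa_y sigma aC) = gwa_y tau aC].
Proof.
move=> st; apply: gwa_lift => [||r|r].
- exact: gwa_yxE.
- by rewrite st gwa_xyE.
- by rewrite st gwa_xrE.
- by rewrite (aut_inv_eq (s := aut_inv tau r)) ?gwa_yrE // st aut_invK.
Qed.

Lemma gwa_eq_aut (sigma tau : algAut R) :
  sigma =1 tau -> algIso (gwa sigma aC) (gwa tau aC).
Proof.
move=> st; have [f [fc fx fy]] := gwa_eq_aut_hom st.
have [g [gc gx gy]] := gwa_eq_aut_hom (fsym st).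
exists f; exists g.
  apply: (gwa_hom_ext (f := g \o f) (g := idfun)) => [r||] /=.
  - by rewrite fc.
  - by rewrite fx.
  - by rewrite fy.
apply: (gwa_hom_ext (f := f \o g) (g := idfun)) => [r||] /=.
- by rewrite gc.
- by rewrite gx.
- by rewrite gy.
Qed.

End EqualAut.

(** * Commutativity over the identity automorphism of any commutative base *)

Definition identity_aut (k : fieldType) (R : algType k) : algAut R :=
  @AlgAut k R idfun id (fun=> erefl) (fun=> erefl).

Lemma gwa_identity_comm (k : fieldType) (R : comAlgType k) (a : R) :
  commutative (@GRing.mul (gwa (identity_aut R) (mulrC a))).
Proof.
set A := gwa _ _; set c := gwa_const (identity_aut R) (mulrC a).
set x : A := gwa_x _ _; set y : A := gwa_y _ _.
(* The elements commuting with [u] form a subring, so generators suffice. This is used first for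
   [v], then for [u]. *)
have comm_gen (u : A) : (forall r, GRing.comm u (c r)) -> GRing.comm u x ->
    GRing.comm u y -> forall v, GRing.comm u v.
  move=> uc ux uy; apply: gwa_elim => // [v w|v|v w].
  - exact: commrD.
  - exact: commrN.
  - exact: commrM.
have cc r s : GRing.comm (c r) (c s) by rewrite /GRing.comm -!rmorphM mulrC.
have xc r : GRing.comm x (c r) by exact: gwa_xrE.
have yc r : GRing.comm y (c r) by exact: gwa_yrE.
have xy : GRing.comm x y by rewrite /GRing.comm gwa_xyE gwa_yxE.
move=> u v; move: v; apply: (comm_gen) => [r||]; apply/commr_sym; move: u.
- apply: (comm_gen) => [s||]; [exact: cc|exact/commr_sym/xc|exact/commr_sym/yc].
- by apply: (comm_gen).
- by apply: (comm_gen) => //; apply/commr_sym.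
Qed.

(** * Commutative images over [h |-> q h] with [q != 1] *)

Section ScaleHom.
Variables (k : fieldType) (q : k) (q0 : q != 0) (a : laurent k).
Hypothesis q1 : q != 1.
Local Notation A := (gwa (scale_aut q0) (mulrC a)).
Local Notation const := (gwa_const (scale_aut q0) (mulrC a)).
Variables (B : algType k) (F : {lrmorphism A -> B}).
Hypothesis Fcomm : forall u v, F u * F v = F v * F u.

(** In a commutative image the relation becomes [(1 - c) F(u) F(h) = 0], where [1 - c] and [F(h)]
    are both invertible. *)
Lemma scale_hom_kill (u : A) (c : k) :
  c != 1 -> u * const (laurent_h k) = const (c *: laurent_h k) * u -> F u = 0.
Proof.
move=> c1 uh.
have uE : F u = F u * F (const (laurent_h k)) * F (const (laurent_hV k)).
  by rewrite -mulrA -!rmorphM laurent_mulhV !rmorph1 mulr1.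
suff uh0 : F u * F (const (laurent_h k)) = 0 by rewrite uE uh0 mul0r.
have : (1 - c) *: (F u * F (const (laurent_h k))) = 0.
  rewrite scalerBl scale1r [X in _ - _ *: X]Fcomm -!rmorphM uh -linearZ /=.
  by rewrite scalerAl -linearZ subrr.
by move/eqP; rewrite scaler_eq0 subr_eq0 eq_sym (negPf c1) => /eqP.
Qed.

(** The preceding lemma kills [x] with factor [q] and [y] with factor [q^-1], so only the constants
    contribute to the image. *)
Lemma scale_hom_image u : exists r, F u = F (const r).
Proof.
elim/gwa_elim: u => [r|||u v [r ur] [s vs]|u [r ur]|u v [r ur] [s vs]].
- by exists r.
- exists 0; rewrite !rmorph0; apply: (scale_hom_kill q1).
  by rewrite gwa_xrE scale_autE.
- exists 0; rewrite !rmorph0; apply: (@scale_hom_kill _ q^-1).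
    by rewrite invr_eq1.
  rewrite gwa_yrE (aut_inv_eq (s := q^-1 *: laurent_h k)) //.
  by rewrite linearZ /= scale_autE scalerA mulVf // scale1r.
- by exists (r + s); rewrite !rmorphD /= ur vs.
- by exists (- r); rewrite !rmorphN /= ur.
- by exists (r * s); rewrite !rmorphM /= ur vs.
Qed.

End ScaleHom.

(** * The quotient of [k[X]] by [X^2 - q] *)

Section QuadraticQuotient.
Variables (k : fieldType) (q : k).
Local Notation E := {poly %/ ('X^2 - q%:P)}.
Local Notation root := (in_qpoly ('X^2 - q%:P) 'X).

Lemma size_X2subC : size ('X^2 - q%:P) = 3%N.
Proof. by rewrite size_XnsubC. Qed.

Lemma qpoly_root_sqr : root ^+ 2 = q%:A :> E.
Proof.
(* The quotient type reduces modulo [mk_monic] of the given polynomial, which leaves a monic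
   nonconstant one unchanged. *)
have mE : mk_monic ('X^2 - q%:P) = 'X^2 - q%:P.
  by rewrite /mk_monic size_X2subC monicXnsubC.
rewrite -rmorphXn /= -[X in in_qpoly _ X](subrK q%:P) in_qpolyD.
rewrite -[in X in _ + in_qpoly _ X]alg_polyC in_qpolyZ in_qpoly1.
suff -> : in_qpoly ('X^2 - q%:P) ('X^2 - q%:P) = 0 by rewrite add0r.
by apply/val_inj; rewrite /= mE Pdiv.RingMonic.rmodpp ?monicXnsubC.
Qed.

Lemma qpoly_root_scalar c : root <> c%:A :> E.
Proof.
(* The reduced representatives differ in their coefficient of degree 1. *)
move/(congr1 (fun e : E => (e : {poly k})`_1)).
rewrite qpolyXE ?size_X2subC ?monicXnsubC //.
rewrite poly_of_qpolyZ coefX coefZ /= coef1 mulr0.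
by move/eqP; rewrite oner_eq0.
Qed.

End QuadraticQuotient.

(** * A commutative image over [h |-> q h^-1] *)

Section InvHom.
Variables (k : fieldType) (q : k) (q0 : q != 0) (b : laurent k).
Local Notation A := (gwa (inv_aut q0) (mulrC b)).
Local Notation E := ({poly %/ ('X^2 - q%:P)} : comAlgType k).
Local Notation rt := (in_qpoly ('X^2 - q%:P) 'X : E).

Fact qpoly_root_inv : rt * (q^-1 *: rt) = 1.
Proof.
by rewrite -scalerAr -expr2 qpoly_root_sqr scalerA mulVf // scale1r.
Qed.

(** The map [ev] sends [h] to [rt] and [h^-1] to [q^-1 *: rt], hence [q h^-1] to [rt] as well. So
    [ev] absorbs [inv_aut], and the defining relations of [A] hold in the target with
    [beta = ev b]. *)
Lemma inv_hom : exists (beta : E)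
  (f : {lrmorphism A -> gwa (identity_aut E) (mulrC beta)}),
  f (gwa_const _ _ (laurent_h k)) = gwa_const _ _ rt /\
  f (gwa_x _ _) = gwa_x _ _.
Proof.
pose ev : {lrmorphism laurent k -> E} := laurent_eval qpoly_root_inv.
pose C := gwa (identity_aut E) (mulrC (ev b)).
pose phi : {lrmorphism laurent k -> C} :=
  gwa_const (identity_aut E) (mulrC (ev b)) \o ev.
have evs r : ev (inv_aut q0 r) = ev r.
  apply: (laurent_hom_ext (f := ev \o inv_aut q0) (g := ev)) => /=.
  rewrite inv_autE linearZ /= laurent_eval_hV laurent_eval_h.
  by rewrite scalerA divff // scale1r.
have [||r|r|f [fc fx _]] := @gwa_lift k _ (inv_aut q0) b (mulrC b) C phi
  (gwa_x _ _) (gwa_y _ _).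
- by rewrite gwa_yxE.
- by rewrite gwa_xyE /= evs.
- by rewrite /= evs gwa_xrE.
- by rewrite /= evs gwa_yrE.
by exists (ev b), f; rewrite fc fx /= laurent_eval_h.
Qed.

End InvHom.

(** * Separation of the second and third families *)

Lemma scale_inv_not_iso (k : fieldType) (q p : k) (q0 : q != 0) (p0 : p != 0)
    (a b : laurent k) :
  q != 1 -> ~ algIso (laurent_gwa (scale_aut q0) a) (laurent_gwa (inv_aut p0) b).
Proof.
move=> q1 [phi [psi _ psiK]]; have [beta [f [fh fx]]] := inv_hom p0 b.
pose F := f \o phi : {lrmorphism _ -> _}.
have Fcomm u v : F u * F v = F v * F u by apply: gwa_identity_comm.
(* As [phi] is onto, [f] and [F] have the same image, which consists of images of Laurent
   polynomials. *)
have img w : exists r, f w = F (gwa_const _ _ r).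
  have [r rE] := scale_hom_image q1 Fcomm (psi w).
  by exists r; rewrite -rE /= psiK.
pose G := F \o gwa_const (scale_aut q0) (mulrC a) : {lrmorphism _ -> _}.
have [r] := img (gwa_const _ _ (laurent_h k)); rewrite fh => rE.
have [s] := img (gwa_x _ _); rewrite fx => sE.
have Gr2 : G (r ^+ 2 - p%:A) = 0.
  have Gr : G r = gwa_const _ _ (in_qpoly _ 'X) := esym rE.
  have GA : G p%:A = p%:A by rewrite linearZ rmorph1.
  transitivity (G r ^+ 2 - G p%:A); first by rewrite rmorphB rmorphXn.
  rewrite Gr GA -rmorphXn /= qpoly_root_sqr.
  by rewrite linearZ /= rmorph1 subrr.
(* Here [G r] is the root and [G s] is [x]. If [r ^+ 2 = p], then [r], and with it the root, is
   scalar. Otherwise [r ^+ 2 - p] is a nonzero element of the kernel of [G], which makes [x]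
   algebraic. *)
have [/(laurent_sqr_scalar p0) [c rc]|r2] := eqVneq (r ^+ 2) p%:A.
  apply: (@qpoly_root_scalar k p c).
  apply: (@gwa_const_inj _ _ (identity_aut _) _ (mulrC beta)).
  by rewrite rE rc !linearZ !rmorph1.
have [P [n PE]] := laurent_polyVP (r ^+ 2 - p%:A).
have P0 : P != 0.
  by apply: contra_neq r2 => P0; apply/eqP; rewrite -subr_eq0 PE P0 rmorph0 mul0r.
have GP : G (laurent_poly P) = 0.
  (* Clearing the denominator gives a nonzero polynomial in the kernel. *)
  have -> : laurent_poly P = (r ^+ 2 - p%:A) * laurent_h k ^+ n.
    by rewrite PE -mulrA [X in _ * X]mulrC laurent_hXK mulr1.
  transitivity (G (r ^+ 2 - p%:A) * G (laurent_h k ^+ n)); first exact: rmorphM.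
  by rewrite Gr2 mul0r.
have Gs : G s = gwa_x _ _ := esym sE.
have [m [c [[i ci]]]] := laurent_ker_algebraic s P0 GP.
rewrite Gs => /gwa_x_transcendental /(_ i) /eqP.
by rewrite (negPf ci).
Qed.

(** * Existence and uniqueness of the family *)

Theorem proposition1p2 (k : fieldType) (sigma : algAut (laurent k))
    (a : laurent k) :
  let A := laurent_gwa sigma a in
  [\/ in_id_family A, in_scale_family A | in_inv_family A] /\
  [/\ ~ (in_id_family A /\ in_scale_family A),
      ~ (in_id_family A /\ in_inv_family A) &
      ~ (in_scale_family A /\ in_inv_family A)].
Proof.
have id_comm b : commutative (@GRing.mul (laurent_gwa (id_aut k) b)).
  exact: gwa_identity_comm.
move=> A; split; last split.
- have [q [q0 sh]] := laurent_aut_h sigma.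
  (* An automorphism is determined by its value at [h], so matching that value keeps the same
     [a]. *)
  have ext (tau : algAut (laurent k)) :
      sigma (laurent_h k) = tau (laurent_h k) -> algIso A (laurent_gwa tau a).
    by move=> st; apply/gwa_eq_aut/laurent_hom_ext.
  case: sh => sh; last first.
    by constructor 3; exists q, q0, a; apply: ext; rewrite inv_autE.
  have [q1|q1] := eqVneq q 1.
    by constructor 1; exists a; apply: ext; rewrite sh q1 scale1r.
  by constructor 2; exists q, q0, a; split=> //; apply: ext; rewrite scale_autE.
- move=> [[b Ab] [q [q0 [c [q1 Ac]]]]].
  (* Commutativity passes to the algebra over [scale_aut], whose automorphism then fixes [h],
     against [q != 1]. *)
  have Acomm := algIso_comm (algIso_trans (algIso_sym Ac) Ab) (id_comm b).
  have := gwa_comm_aut Acomm (laurent_h k).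
  rewrite scale_autE -[in LHS](expr1 (laurent_h k)) -[RHS]scale1r.
  rewrite -[in RHS](expr1 (laurent_h k)).
  by case/(laurent_scale_hX_inj q0) => /eqP; rewrite (negPf q1).
- move=> [[b Ab] [q [q0 [c Ac]]]].
  (* Likewise [inv_aut] would fix [h], but [q h^-1] is never [h]. *)
  have Acomm := algIso_comm (algIso_trans (algIso_sym Ac) Ab) (id_comm b).
  have := gwa_comm_aut Acomm (laurent_h k).
  rewrite inv_autE -(expr1 (laurent_hV k)) -[RHS]scale1r -(expr1 (laurent_h k)).
  by case/(laurent_scale_hVX_hX q0) => [[]].
- move=> [[q [q0 [b [q1 Ab]]]] [p [p0 [c Ac]]]].
  exact: (scale_inv_not_iso q1 (algIso_trans (algIso_sym Ab) Ac)).
Qed.
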